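(* For $i=1,2$, let $(X_i,\tau_i)$ be a Tychonoff space, let $(Y_i,f_i)$ be a Hausdorff local compactification of $(X_i,\tau_i)$, and let $\rho_i$ and $\mathbb{B}_i$ be defined by: for $F,G\in RC(X_i)$, $F\rho_i G$ iff $\mathrm{cl}_{Y_i}(f_i(F))\cap\mathrm{cl}_{Y_i}(f_i(G))\neq\emptyset$, and $\mathbb{B}_i=\{f_i^{-1}(K): K\in CR(Y_i)\}$. Let $f:X_1\to X_2$ be an R-equicontinuous function (with respect to $(\rho_1,\mathbb{B}_1)$ and $(\rho_2,\mathbb{B}_2)$), and let $g:Y_1\to Y_2$ be the continuous function such that $g\circ f_1=f_2\circ f$. Then: (a) $g$ is skeletal iff $f$ is skeletal; (b) $g$ is an open map iff $f$ is a skeletal map and satisfies the following condition: (O) for all $F\in\mathbb{B}_1$ and all $G\in RC(X_1)$, $F\ll_{\rho_1}G$ implies $\mathrm{cl}_{X_2}(f(F))\ll_{\rho_2}\mathrm{cl}_{X_2}(f(G))$; (b$'$) $g$ is an open map iff $f$ satisfies the following condition: (O1) for all $F\in\mathbb{B}_1$ and all $G\in RC(X_1)$, $F\ll_{\rho_1}G$ implies $\mathrm{cl}_{X_2}(f(F))\ll_{\rho_2'}\mathrm{cl}_{X_2}(f(G))$; (b$''$) $g$ is an open map iff $f$ satisfies the following condition: (O2) for all $A\subseteq X_1$ such that there exists $F\in\mathbb{B}_1$ with $A\subseteq F$, and for all $B\subseteq X_1$, $A\ll_{\rho_1'}B$ implies $f(A)\ll_{\rho_2'}\mathrm{cl}_{X_2}(f(B))$;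 (c) $g$ is a perfect map iff $f$ satisfies the following condition: (P) for every $G\in\mathbb{B}_2$, $\mathrm{cl}_{X_1}(f^{-1}(\mathrm{int}_{X_2}(G)))\in\mathbb{B}_1$; (d) $\mathrm{cl}_{Y_2}(g(Y_1))=Y_2$ iff $\mathrm{cl}_{X_2}(f(X_1))=X_2$; (e) $g$ is an injection iff $f$ satisfies the following condition: (I) for every $F_1,F_2\in\mathbb{B}_1$ such that $F_1(-\rho_1)F_2$ there exist $G_1,G_2\in\mathbb{B}_2$ with $G_1\ll_{\rho_2}G_2$, $F_1\subseteq\mathrm{cl}_{X_1}(f^{-1}(\mathrm{int}_{X_2}(G_1)))$ and $\mathrm{cl}_{X_1}(f^{-1}(\mathrm{int}_{X_2}(G_2)))(-\rho_1)F_2$; (f) $g$ is an open injection iff both of the following hold: first, for all $F\in\mathbb{B}_1$ and all $G\in RC(X_1)$, $F\ll_{\rho_1}G$ implies $\mathrm{cl}_{X_2}(f(F))\ll_{\rho_2'}\mathrm{cl}_{X_2}(f(G))$ (or, equivalently, $f$ is skeletal and, for all $F\in\mathbb{B}_1$ and all $G\in RC(X_1)$, $F\ll_{\rho_1}G$ implies $\mathrm{cl}_{X_2}(f(F))\ll_{\rho_2}\mathrm{cl}_{X_2}(f(G))$); and second, (OI) for every $F\in RC(X_1)$ there exists $G\in RC(X_2)$ such that $F=\mathrm{cl}_{X_1}(f^{-1}(\mathrm{int}_{X_2}(G)))$; (g) $g$ is a perfect surjection iff $\mathrm{cl}_{X_1}(f^{-1}(\mathrm{int}_{X_2}(G)))\in\mathbb{B}_1$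 for every $G\in\mathbb{B}_2$, and $\mathrm{cl}_{X_2}(f(X_1))=X_2$.
   Context: For a topological space $X$, $RC(X)$ is the Boolean algebra of all regular closed subsets ($F=\mathrm{cl}(\mathrm{int}(F))$), with $F^*=\mathrm{cl}(X\setminus F)$, and $CR(X)$ is the set of compact regular closed subsets. A Hausdorff local compactification of a Tychonoff space $X$ is a pair $(Y,f)$ with $Y$ locally compact Hausdorff and $f:X\to Y$ a homeomorphic embedding with dense image. ''$(-\rho)$'' means ''not $\rho$''. For $F,G\in RC(X_i)$, $F\ll_{\rho_i}G$ means $F(-\rho_i)G^*$. A continuous function $f:X_1\to X_2$ is R-equicontinuous if: (REQ1) for every $F,G\in RC(X_2)$, $\mathrm{cl}_{X_1}(\mathrm{int}_{X_1}(f^{-1}(F)))\ \rho_1\ \mathrm{cl}_{X_1}(\mathrm{int}_{X_1}(f^{-1}(G)))$ implies $F\rho_2G$; and (REQ2) for every $F\in\mathbb{B}_1$ there is $G\in\mathbb{B}_2$ with $f(F)\subseteq G$. For such $f$ the continuous $g:Y_1\to Y_2$ with $g\circ f_1=f_2\circ f$ exists, and it is unique because $f_1(X_1)$ is dense in $Y_1$. A function $f:X\to Y$ between topological spaces is skeletal if $\mathrm{int}(f^{-1}(\mathrm{cl}(V)))\subseteq\mathrm{cl}(f^{-1}(V))$ for every open $V\subseteq Y$. If a continuous $f$ is skeletal then $\mathrm{cl}(f(F))\in RC(Y)$ for each $F\in RC(X)$, so that for skeletal $f:X_1\to X_2$ and $F,G\in RC(X_1)$ the relation $\mathrm{cl}_{X_2}(f(F))\ll_{\rho_2}\mathrm{cl}_{X_2}(f(G))$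 makes sense. Open maps and closed maps are assumed continuous, not necessarily onto; a map is perfect if it is closed and has compact point inverses. For $i=1,2$, $\rho_i'$ is the relation on arbitrary subsets of $X_i$ given as follows: put $\mathcal{B}_i=\{M\subseteq X_i: M\subseteq B\text{ for some }B\in\mathbb{B}_i\}$; for $M,N\subseteq X_i$, $M(-\rho_i')N$ iff for every $B\in\mathcal{B}_i$ there exist $F,G\in RC(X_i)$ with $M\cap B\subseteq\mathrm{int}_{X_i}(F)$, $N\cap B\subseteq\mathrm{int}_{X_i}(G)$ and $F(-\rho_i)G$. ($(X_i,\rho_i',\mathcal{B}_i)$ is the unique separated local proximity space in the sense of Leader on $(X_i,\tau_i)$ such that $\rho_i'$ restricted to $RC(X_i)$ is $\rho_i$ and $\mathcal{B}_i\cap RC(X_i)=\mathbb{B}_i$.) For $M,N\subseteq X_i$, $M\ll_{\rho_i'}N$ means $M(-\rho_i')(X_i\setminus N)$. *)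

(* Defs.v *)
From mathcomp Require Import all_boot all_classical all_reals.
From mathcomp Require Import topology normedtype.

Set Implicit Arguments.
Unset Strict Implicit.
Unset Printing Implicit Defensive.

Local Open Scope classical_set_scope.

Definition tychonoff_space (X : topologicalType) : Prop :=
  completely_regular_space X /\ hausdorff_space X.

(* A homeomorphism onto its image, the image carrying the topology induced
   from Y. *)
Definition homeo_embedding (X Y : topologicalType) (f : X -> Y) : Prop :=
  [/\ injective f, continuous f &
      forall U : set X, open U ->
        exists2 V : set Y, open V & f @` U = V `&` range f].

Definition hausdorff_local_compactification (X Y : topologicalType)
    (f : X -> Y) : Prop :=
  [/\ hausdorff_space Y, locally_compact [set: Y],
      homeo_embedding f & dense (range f)].

Definition open_map (X Y : topologicalType) (f : X -> Y) : Prop :=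
  continuous f /\ forall U : set X, open U -> open (f @` U).

Definition closed_map (X Y : topologicalType) (f : X -> Y) : Prop :=
  continuous f /\ forall C : set X, closed C -> closed (f @` C).

Definition perfect_map (X Y : topologicalType) (f : X -> Y) : Prop :=
  closed_map f /\ forall y : Y, compact (f @^-1` [set y]).

Definition skeletal (X Y : topologicalType) (f : X -> Y) : Prop :=
  forall V : set Y, open V ->
    interior (f @^-1` (closure V)) `<=` closure (f @^-1` V).

Section RegularClosed.
Context {X : topologicalType}.
Implicit Types (F G M N : set X) (rho : set X -> set X -> Prop)
  (BB : set (set X)).

(* RC X, CR X, and the Boolean complement of RC X. *)
Definition RC : set (set X) := [set F | regclosed F].
Definition CR : set (set X) := [set F | compact F /\ regclosed F].
Definition rc_compl F : set X := closure (~` F).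

(* F <<_rho G.  It is meant for a relation rho on RC X, and is only used at
   regular closed F and G. *)
Definition rc_ll rho F G : Prop := ~ rho F (rc_compl G).

Definition bounded_subsets BB : set (set X) :=
  [set M | exists2 B, BB B & M `<=` B].

(* The local proximity rho' induced by (rho, BB) on arbitrary subsets; what is
   described explicitly is its negation. *)
Definition prox_ext rho BB M N : Prop :=
  ~ (forall B, bounded_subsets BB B ->
       exists F G, [/\ RC F, RC G, M `&` B `<=` interior F,
                       N `&` B `<=` interior G & ~ rho F G]).

Definition ext_ll rho BB M N : Prop := ~ prox_ext rho BB M (~` N).

End RegularClosed.
Arguments RC : clear implicits.
Arguments CR : clear implicits.

Section InducedByCompactification.
Context {X Y : topologicalType}.
Variable f : X -> Y.

(* Although defined for all pairs of subsets, it is only used on RC X. *)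
Definition lc_prox (F G : set X) : Prop :=
  closure (f @` F) `&` closure (f @` G) !=set0.

Definition lc_bounded : set (set X) := [set f @^-1` K | K in CR Y].

End InducedByCompactification.

Section Conditions.
Context {X1 X2 : topologicalType}.
Variables (rho1 : set X1 -> set X1 -> Prop) (BB1 : set (set X1)).
Variables (rho2 : set X2 -> set X2 -> Prop) (BB2 : set (set X2)).
Variable f : X1 -> X2.

Definition R_equicontinuous : Prop :=
  [/\ continuous f,
      forall F G : set X2, RC X2 F -> RC X2 G ->
        rho1 (closure (interior (f @^-1` F))) (closure (interior (f @^-1` G))) ->
        rho2 F G &
      forall F : set X1, BB1 F -> exists2 G : set X2, BB2 G & f @` F `<=` G].

(* Only meaningful for skeletal f, where the two closures are in RC X2. *)
Definition cond_O : Prop :=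
  forall F G : set X1, BB1 F -> RC X1 G -> rc_ll rho1 F G ->
    rc_ll rho2 (closure (f @` F)) (closure (f @` G)).

Definition cond_O1 : Prop :=
  forall F G : set X1, BB1 F -> RC X1 G -> rc_ll rho1 F G ->
    ext_ll rho2 BB2 (closure (f @` F)) (closure (f @` G)).

Definition cond_O2 : Prop :=
  forall A : set X1, (exists2 F : set X1, BB1 F & A `<=` F) ->
  forall B : set X1, ext_ll rho1 BB1 A B ->
    ext_ll rho2 BB2 (f @` A) (closure (f @` B)).

Definition cond_P : Prop :=
  forall G : set X2, BB2 G -> BB1 (closure (f @^-1` (interior G))).

Definition cond_I : Prop :=
  forall F1 F2 : set X1, BB1 F1 -> BB1 F2 -> ~ rho1 F1 F2 ->
  exists G1 G2 : set X2,
    [/\ BB2 G1, BB2 G2, rc_ll rho2 G1 G2,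
        F1 `<=` closure (f @^-1` (interior G1)) &
        ~ rho1 (closure (f @^-1` (interior G2))) F2].

Definition cond_OI : Prop :=
  forall F : set X1, RC X1 F ->
  exists2 G : set X2, RC X2 G & F = closure (f @^-1` (interior G)).

End Conditions.

(* Main.v *)
Require Import Defs.
From mathcomp Require Import all_boot all_classical all_reals.
From mathcomp Require Import topology normedtype.

Set Implicit Arguments.
Unset Strict Implicit.
Unset Printing Implicit Defensive.

Local Open Scope classical_set_scope.

(** The embeddings [f1] and [f2] make [X1] and [X2] dense subspaces of the
    locally compact Hausdorff spaces [Y1] and [Y2], and every condition on [f]
    in the theorem is the trace on [X1] and [X2] of a condition on [g], phrased
    with compact sets and neighbourhoods in [Y1] and [Y2]. The proof consists
    of a dictionary, valid for one dense embedding [e : X -> Y], and of an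
    argument about [g] alone for each clause.

    Dictionary. For an open [V] and a closed [K] in [Y], the preimage by [e]
    commutes with the closure of [V] and with the interior of [K]
    ([closure_preimage_open], [interior_preimage_closed]), so that taking the
    closure of the image and taking the preimage are inverse bijections between
    the regular closed sets of [X] and of [Y]; the bounded ones correspond to
    the compact ones. The relation [rc_ll] compares the closure of [F] in [Y]
    with the largest open set [extent e G] of [Y] whose trace lies in [G]
    ([rc_ll_lc_proxE]). Since [Y] is locally compact, disjoint closures of
    bounded sets can be separated by compact regular closed sets, and therefore
    [prox_ext] agrees with [lc_prox] on all pairs of sets
    ([prox_ext_lc_proxE]). In particular (O) and (O1) are the same condition.

    Openness. If [g] is open, it maps the closure of a bounded [A], a compact
    set, onto the closure of [f A], and it maps [extent f1 B] onto an open set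
    whose trace lies in the closure of [f B]; this is (O2), which contains
    (O1). If (O) holds and [U] is a neighbourhood of [y], take compact regular
    closed neighbourhoods [K] and [H] of [y] with [K] in the interior of [H]
    and [H] in [U]. Applied to the traces of [K] and [H], (O) says that [g K]
    lies in an open set contained in the closed set [g H]. So [g U] is a
    neighbourhood of [g y].

    Remaining clauses. (P) says that the closure of the preimage by [g] of the
    interior of [K] is compact for every compact regular closed [K]; by local
    compactness this means that preimages of compact sets are compact, which is
    perfectness. (I) separates the images by [g] of disjoint compact sets,
    hence of distinct points. For an open [g] the closure of a preimage is the
    preimage of the closure, so (OI) says that every regular closed set of [Y1]
    is the full preimage of a regular closed set; such preimages cannot
    separate two points with the same image. Density and skeletality are
    transported by the dictionary directly. *)

(** * Continuous maps, closures and compactness *)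

Lemma closure_sub_closed (T : topologicalType) (A B : set T) :
  closed B -> A `<=` B -> closure A `<=` B.
Proof. by move=> clB AB; exact: subset_trans (closureS AB) clB. Qed.

Lemma open_sub_interior_closure (T : topologicalType) (V : set T) :
  open V -> V `<=` interior (closure V).
Proof.
move=> oV; rewrite -{1}((interior_id _).1 oV).
exact/interiorS/subset_closure.
Qed.

Lemma regclosed_closed (T : topologicalType) (K : set T) :
  regclosed K -> closed K.
Proof. by move=> <-; exact: closed_closure. Qed.

Lemma image_closure (S T : topologicalType) (h : S -> T) (A : set S) :
  continuous h -> h @` closure A `<=` closure (h @` A).
Proof.
move=> ch _ [x clx <-] W /ch /clx [a [Aa Wa]].
by exists (h a); split => //; exists a.
Qed.

Lemma closure_image_closure (S T : topologicalType) (h : S -> T) (A : set S) :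
  continuous h -> closure (h @` closure A) = closure (h @` A).
Proof.
move=> ch; apply/seteqP; split; last exact/closureS/image_subset/subset_closure.
apply: closure_sub_closed; [exact: closed_closure|exact: image_closure].
Qed.

Lemma continuous_compact_image (S T : topologicalType) (h : S -> T)
    (A : set S) :
  continuous h -> compact A -> compact (h @` A).
Proof.
by move=> ch; apply: continuous_compact; apply: continuous_subspaceT.
Qed.

(** The image of a compact closure is compact, hence already closed. *)
Lemma closure_image_compact (S T : topologicalType) (h : S -> T) (A : set S) :
  hausdorff_space T -> continuous h -> compact (closure A) ->
  closure (h @` A) = h @` closure A.
Proof.
move=> hT ch cA; rewrite -closure_image_closure//; apply/esym/closure_id.
by apply: compact_closed => //; exact: continuous_compact_image.
Qed.

(** A neighbourhood of [x] has as image a neighbourhood of [h x], so it meets the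
    preimage of every set that clusters at [h x]. *)
Lemma open_map_preimage_closure (S T : topologicalType) (h : S -> T)
    (B : set T) :
  open_map h -> closure (h @^-1` B) = h @^-1` closure B.
Proof.
move=> [ch oh]; apply/seteqP; split.
  move=> x clx W /ch /clx [z [Bz Wz]].
  by exists (h z).
move=> x clx W; rewrite nbhsE => -[U [oU Ux] UW].
have [|w [Bw [z Uz hz]]] := clx (h @` U).
  by apply: open_nbhs_nbhs; split; [exact: oh|exists x].
by exists z; split; [rewrite /preimage/= hz|exact: UW].
Qed.

Lemma open_map_skeletal (S T : topologicalType) (h : S -> T) :
  open_map h -> skeletal h.
Proof.
by move=> oh V _; rewrite open_map_preimage_closure//; exact: interior_subset.
Qed.

(** Otherwise the sets [A] such that [Q] holds of the part of [C] outside [A]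
    form a proper filter on [C], and a neighbourhood satisfying [Q] of a cluster
    point contradicts the clustering. *)
Lemma compact_induction (T : topologicalType) (Q : set T -> Prop)
    (C : set T) :
  compact C -> Q set0 -> (forall A B, A `<=` B -> Q B -> Q A) ->
  (forall A B, Q A -> Q B -> Q (A `|` B)) ->
  (forall x, C x -> exists2 U, nbhs x U & Q U) ->
  Q C.
Proof.
move=> cC Q0 QS QU Qx; apply: contrapT => nQC.
pose F : set_system T := [set A | Q (C `\` A)].
have FF : ProperFilter F.
  split; first by rewrite /F/= setD0.
  split.
  - by rewrite /F/= setDT.
  - by move=> A B FA FB; rewrite /F/= setDIr; exact: QU.
  - by move=> A B AB; apply: QS; exact: setDS.
have FC : F C by rewrite /F/= setDv.
have [x [Cx clx]] := cC F FF FC.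
have [U Ux QU'] := Qx x Cx.
have FU : F (~` U) by rewrite /F/= setDE setCK; apply: QS QU' => y [].
by have [z []] := clx _ _ FU Ux.
Qed.

Lemma locally_compact_regular (T : topologicalType) (x : T) (U : set T) :
  hausdorff_space T -> locally_compact [set: T] -> open U -> U x ->
  exists V, [/\ open V, V x, compact (closure V) & closure V `<=` U].
Proof.
move=> hT lT oU Ux; have [K Kx [cK clK]] := lT x I.
have {}Kx : nbhs x K by move: Kx; rewrite withinET.
have UKx : nbhs x (U `&` K).
  by apply: filterI => //; exact: open_nbhs_nbhs.
have [A Ax AKU] := compact_regular hT cK Kx UKx.
have AK : closure (interior A) `<=` U `&` K.
  exact: subset_trans (closureS (@interior_subset _ _)) AKU.
exists (interior A); split; [exact: open_interior|exact: Ax| |by move=> y /AK[]].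
apply: (subclosed_compact _ cK); first exact: closed_closure.
by move=> y /AK [].
Qed.

(** Compact sets behave like points here because the property of having such
    an interpolant is stable under finite unions. *)
Lemma locally_compact_interpolation (T : topologicalType) (C U : set T) :
  hausdorff_space T -> locally_compact [set: T] -> compact C -> open U ->
  C `<=` U ->
  exists V, [/\ open V, C `<=` V, compact (closure V) & closure V `<=` U].
Proof.
move=> hT lT cC oU CU.
pose Q A := exists V, [/\ open V, A `<=` V, compact (closure V) &
                          closure V `<=` U].
apply: (@compact_induction _ Q C) => //.
- exists set0; rewrite closure0; split => //; [exact: open0|exact: compact0].
- by move=> A B AB [V [oV BV cV VU]]; exists V; split=> //; exact: subset_trans BV.
- move=> A B [V [oV AV cV VU]] [W [oW BW cW WU]]; exists (V `|` W).
  rewrite closureU; split; [exact: openU|exact: setUSS|exact: compactU|].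
  by rewrite subUset.
- move=> x /CU Ux.
  have [V [oV Vx cV VU]] := locally_compact_regular hT lT oU Ux.
  by exists V; [apply: open_nbhs_nbhs|exists V; split].
Qed.

(** A filter on the preimage of [K] has an image clustering at some [y] in [K].
    The map being closed, the closure of each member of the filter meets the
    fibre over [y]; by compactness of the fibre, these traces cluster. *)
Lemma perfect_preimage_compact (S T : topologicalType) (h : S -> T)
    (K : set T) :
  perfect_map h -> compact K -> compact (h @^-1` K).
Proof.
move=> [[ch clh] fib] cK F FF FK.
have [y [Ky cly]] : K `&` cluster (h @ F) !=set0 by apply: cK.
pose G := filter_from F (fun A => h @^-1` [set y] `&` closure A).
have PG : ProperFilter G.
  apply: (filter_from_proper (filter_from_filter _ _)).
  - by exists setT; exact: filterT.
  - move=> A B FA FB; exists (A `&` B); first exact: filterI.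
    by move=> x [hx /closureI[clA clB]]; split.
  - move=> A FA; have : closure (h @` closure A) y.
      have hFA : F (h @^-1` (h @` A)) by apply: filterS FA => x Ax; exists x.
      move=> W Wy; have [_ [[x Ax <-] Wx]] := cly _ _ hFA Wy.
      by exists (h x); split => //; exists x => //; exact: subset_closure.
    rewrite -(closure_id _).1; last exact/clh/closed_closure.
    by move=> [x clx hx]; exists x.
have [|p [hp clp]] := fib y G PG; first by exists setT; [exact: filterT|move=> x []].
exists p; split; first by rewrite /preimage/= hp.
rewrite clusterE => A FA; apply: closed_closure => W Wp.
have GA : G (h @^-1` [set y] `&` closure A) by exists A.
by have [z [[_ Az] Wz]] := clp _ _ GA Wp; exists z.
Qed.

(** Locally, near [y], the image of a closed set is the image of its part over
    a compact neighbourhood of [y]; that part is compact, so its image is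
    closed. *)
Lemma compact_preimage_perfect (S T : topologicalType) (h : S -> T) :
  hausdorff_space T -> locally_compact [set: T] -> continuous h ->
  (forall K, compact K -> compact (h @^-1` K)) -> perfect_map h.
Proof.
move=> hT lT ch hK; split; last by move=> y; apply/hK/compact_set1.
split=> // C clC y cly.
have [V [oV Vy cV _]] := locally_compact_regular hT lT openT (I : setT y).
have clD : closed (h @` (C `&` h @^-1` closure V)).
  apply: compact_closed => //; apply: continuous_compact_image => //.
  by rewrite setIC; apply: compact_closedI => //; exact: hK.
have [|z [Cz _] hz] := clD y; last by exists z.
move=> W Wy; have [|z [[x Cx hx] [Wz Vz]]] := cly (W `&` V).
  by apply: filterI => //; exact: open_nbhs_nbhs.
exists z; split => //; exists x => //; split => //.
by rewrite /preimage/= hx; exact: subset_closure.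
Qed.

(** * Traces on a dense subspace *)

Section DenseEmbedding.
Context {X Y : topologicalType} {e : X -> Y}.
Hypotheses (he : homeo_embedding e) (de : dense (range e)).

Let ce : continuous e. Proof. by case: he. Qed.

Lemma open_is_trace (U : set X) :
  open U -> exists2 V, open V & U = e @^-1` V.
Proof.
case: he => ie _ oe /oe [V oV eUV]; exists V => //.
apply/seteqP; split=> x.
  by move=> Ux; have [] : (V `&` range e) (e x) by rewrite -eUV; exists x.
move=> Vx; have [z Uz /ie <-//] : (e @` U) (e x).
by rewrite eUV; split => //; exists x.
Qed.

(** This expresses that [X] carries the subspace topology. *)
Lemma preimage_closure_image (A : set X) :
  e @^-1` closure (e @` A) = closure A.
Proof.
apply/seteqP; split=> x; last by move=> clx; apply: image_closure => //; exists x.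
move=> clx W; rewrite nbhsE => -[U [/open_is_trace [V oV ->] Vx] UW].
have [|_ [[a Aa <-] Va]] := clx V; first exact: open_nbhs_nbhs.
by exists a; split => //; exact: UW.
Qed.

(** This expresses density: a nonempty open subset of [V] meets the range. *)
Lemma closure_image_preimage (V : set Y) :
  open V -> closure (e @` (e @^-1` V)) = closure V.
Proof.
move=> oV; apply/seteqP; split; first by apply: closureS => _ [x Vx <-].
move=> y cly W; rewrite nbhsE => -[U [oU Uy] UW].
have [z Vz] := cly U (open_nbhs_nbhs (conj oU Uy)).
have [|w [[Vw Uw] [x _ xw]]] := @de (V `&` U) _ (openI oV oU); first by exists z.
exists w; split; last exact: UW.
by exists x; rewrite /preimage/= ?xw.
Qed.

Lemma closure_preimage_open (V : set Y) :
  open V -> closure (e @^-1` V) = e @^-1` closure V.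
Proof. by move=> oV; rewrite -preimage_closure_image closure_image_preimage. Qed.

Lemma sub_closure_trace (U : set Y) (A : set X) :
  open U -> e @^-1` U `<=` A -> U `<=` closure (e @` A).
Proof.
move=> oU UA; apply: (subset_trans (@subset_closure _ U)).
by rewrite -closure_image_preimage//; apply/closureS/image_subset.
Qed.

(** The interior of the preimage is the trace of an open [V], and [K], being
    closed, contains [V] because it contains the trace of [V]. *)
Lemma interior_preimage_closed (K : set Y) :
  closed K -> interior (e @^-1` K) = e @^-1` interior K.
Proof.
move=> clK; apply/seteqP; split; last by move=> x /ce.
have [V oV VE] := open_is_trace (@open_interior _ (e @^-1` K)).
rewrite VE; apply: preimage_subset; rewrite -{1}((interior_id _).1 oV).
apply: interiorS.
apply: (subset_trans (sub_closure_trace oV (@subset_refl _ _))).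
by rewrite -VE; apply: closure_sub_closed => // _ [z /interior_subset Kz <-].
Qed.

Lemma regclosed_closure_image (F : set X) :
  regclosed F -> regclosed (closure (e @` F)).
Proof.
move=> <-; rewrite closure_image_closure//.
have [V oV ->] := open_is_trace (@open_interior _ F).
by rewrite closure_image_preimage//; exact: closure_open_regclosed.
Qed.

Lemma preimage_closure_image_regclosed (F : set X) :
  regclosed F -> e @^-1` closure (e @` F) = F.
Proof.
move=> rF; rewrite preimage_closure_image -(closure_id _).1//.
exact: regclosed_closed.
Qed.

Lemma closure_image_preimage_regclosed (K : set Y) :
  regclosed K -> closure (e @` (e @^-1` K)) = K.
Proof.
move=> rK; rewrite -{1}rK -closure_preimage_open; last exact: open_interior.
rewrite closure_image_closure// closure_image_preimage//.
exact: open_interior.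
Qed.

Lemma regclosed_preimage (K : set Y) :
  regclosed K -> regclosed (e @^-1` K).
Proof.
move=> rK; rewrite -rK -closure_preimage_open; last exact: open_interior.
apply: closure_open_regclosed.
by move/continuousP: ce; apply; exact: open_interior.
Qed.

Lemma lc_bounded_preimage (K : set Y) :
  regclosed K -> (lc_bounded e (e @^-1` K) <-> compact K).
Proof.
move=> rK; split=> [[L [cL rL] LK]|cK]; last by exists K.
by rewrite -(closure_image_preimage_regclosed rK) -LK
  closure_image_preimage_regclosed.
Qed.

Lemma lc_bounded_closure_preimage (V : set Y) :
  open V -> (lc_bounded e (closure (e @^-1` V)) <-> compact (closure V)).
Proof.
move=> oV; rewrite closure_preimage_open//.
exact/lc_bounded_preimage/closure_open_regclosed.
Qed.

Lemma lc_bounded_compact (F A : set X) :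
  lc_bounded e F -> A `<=` F -> compact (closure (e @` A)).
Proof.
move=> [K [cK rK] <-] AK; apply: (subclosed_compact _ cK).
  exact: closed_closure.
rewrite -(closure_image_preimage_regclosed rK).
exact/closureS/image_subset.
Qed.

(** The largest open set of [Y] whose trace lies in [G], see [sub_extent]: the
    standard operator extending open sets to a space containing [X] densely. *)
Definition extent (G : set X) : set Y := ~` closure (e @` (~` G)).

Lemma open_extent (G : set X) : open (extent G).
Proof. exact/closed_openC/closed_closure. Qed.

Lemma sub_extent (U : set Y) (G : set X) :
  open U -> (U `<=` extent G <-> e @^-1` U `<=` G).
Proof.
move=> oU; split=> [UG x Ux|UG y Uy cly].
  apply: contrapT => nGx; apply: (UG _ Ux).
  by apply: subset_closure; exists x.
have [|_ [[x nGx <-] Ux]] := cly U; first exact: open_nbhs_nbhs.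
exact/nGx/UG.
Qed.

Lemma extent_sub_closure (G : set X) : extent G `<=` closure (e @` G).
Proof.
apply: sub_closure_trace; first exact: open_extent.
by apply/sub_extent => //; exact: open_extent.
Qed.

Lemma extent_preimage_closed (K : set Y) :
  closed K -> extent (e @^-1` K) = interior K.
Proof.
move=> clK; apply/seteqP; split.
  rewrite -[X in X `<=` _](interior_id _).1; last exact: open_extent.
  apply: interiorS; apply: (subset_trans (@extent_sub_closure _)).
  by apply: closure_sub_closed => // _ [x Kx <-].
by apply/sub_extent; [exact: open_interior|move=> x /interior_subset].
Qed.

Lemma not_lc_proxE (F G : set X) :
  ~ lc_prox e F G <-> closure (e @` F) `<=` ~` closure (e @` G).
Proof. by split=> [nFG y Fy Gy|FG [y [/FG]]//]; apply: nFG; exists y. Qed.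

(** The dual of [G] is a closure in [X], which is absorbed by the closure in [Y]. *)
Lemma rc_ll_lc_proxE (F G : set X) :
  rc_ll (lc_prox e) F G <-> closure (e @` F) `<=` extent G.
Proof.
rewrite /rc_ll not_lc_proxE /rc_compl closure_image_closure//.
Qed.

Hypotheses (hY : hausdorff_space Y) (lY : locally_compact [set: Y]).

(** A common point [y] of the closures of [M] and [N] is already in the closures
    of their parts inside a compact neighbourhood of [y], so the trace of that
    neighbourhood is a bounded set on which no separation is possible.
    Conversely, inside a bounded set the closures are compact, and disjoint
    compact sets have neighbourhoods with disjoint compact closures. *)
Lemma prox_ext_lc_proxE (M N : set X) :
  prox_ext (lc_prox e) (lc_bounded e) M N <-> lc_prox e M N.
Proof.
rewrite /prox_ext; split; last first.
  move=> [y [My Ny]] sepMN.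
  have [V [oV Vy cV _]] := locally_compact_regular hY lY openT (I : setT y).
  pose B := e @^-1` closure V.
  (* Points of [P] near [y] lie in [B], hence in every [H] around [P `&` B]. *)
  have near_closure (P H : set X) : closure (e @` P) y ->
      P `&` B `<=` interior H -> closure (e @` H) y.
    move=> Py PH W Wy; have [|_ [[x Px <-] [Wx Vx]]] := Py (W `&` V).
      by apply: filterI => //; exact: open_nbhs_nbhs.
    exists (e x); split => //; exists x => //.
    apply: interior_subset; apply: PH; split => //.
    exact: (@subset_closure _ V).
  have [|F [G [rF rG MF NG]]] := sepMN B.
    by exists B => //; apply/lc_bounded_preimage => //;
      exact: closure_open_regclosed.
  by apply; exists y; split; [exact: near_closure MF|exact: near_closure NG].
move=> nsep; apply: contrapT => /not_lc_proxE MN; apply: nsep => B [B'].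
move=> [K [cK rK] <-] BK.
have [|||V [oV MV cV VN]] := @locally_compact_interpolation _
  (K `&` closure (e @` M)) (~` closure (e @` N)) hY lY.
- by apply: compact_closedI => //; exact: closed_closure.
- exact/closed_openC/closed_closure.
- by move=> y [_ /MN].
have [|||W [oW NW cW WV]] := @locally_compact_interpolation _
  (K `&` closure (e @` N)) (~` closure V) hY lY.
- by apply: compact_closedI => //; exact: closed_closure.
- exact/closed_openC/closed_closure.
- by move=> y [_ Ny] /VN.
have trace (P : set X) (U : set Y) : open U ->
    K `&` closure (e @` P) `<=` U ->
    P `&` B `<=` interior (e @^-1` closure U).
  move=> oU PU; have oeU : open (e @^-1` U) by move/continuousP: ce; apply.
  apply: subset_trans (interiorS (preimage_subset (@subset_closure _ U))).
  rewrite ((interior_id _).1 oeU) => x [Px Bx].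
  by apply: PU; split; [exact: BK|apply: subset_closure; exists x].
exists (e @^-1` closure V), (e @^-1` closure W).
split; [exact/regclosed_preimage/closure_open_regclosed..|exact: trace|
  exact: trace|].
apply/not_lc_proxE.
rewrite !closure_image_preimage_regclosed; try exact: closure_open_regclosed.
by move=> y Vy /WV.
Qed.

Lemma ext_ll_lc_proxE (A B : set X) :
  ext_ll (lc_prox e) (lc_bounded e) A B <-> closure (e @` A) `<=` extent B.
Proof. by rewrite /ext_ll prox_ext_lc_proxE not_lc_proxE. Qed.

End DenseEmbedding.
Arguments extent {X Y} e G.

(** * The extended map *)

Section Extension.
Context {X1 X2 Y1 Y2 : topologicalType}.
Context {f1 : X1 -> Y1} {f2 : X2 -> Y2} {f : X1 -> X2} {g : Y1 -> Y2}.
Hypotheses (lc1 : hausdorff_local_compactification f1)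
  (lc2 : hausdorff_local_compactification f2).
Hypotheses (cg : continuous g) (gf : g \o f1 = f2 \o f).

Local Notation rho1 := (lc_prox f1).
Local Notation rho2 := (lc_prox f2).
Local Notation BB1 := (lc_bounded f1).
Local Notation BB2 := (lc_bounded f2).

Let hY1 : hausdorff_space Y1. Proof. by case: lc1. Qed.
Let hY2 : hausdorff_space Y2. Proof. by case: lc2. Qed.
Let lY1 : locally_compact [set: Y1]. Proof. by case: lc1. Qed.
Let lY2 : locally_compact [set: Y2]. Proof. by case: lc2. Qed.
Let h1 : homeo_embedding f1. Proof. by case: lc1. Qed.
Let h2 : homeo_embedding f2. Proof. by case: lc2. Qed.
Let d1 : dense (range f1). Proof. by case: lc1. Qed.
Let d2 : dense (range f2). Proof. by case: lc2. Qed.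
Let cf2 : continuous f2. Proof. by case: h2. Qed.

Let preimage_gf (W : set Y2) : f @^-1` (f2 @^-1` W) = f1 @^-1` (g @^-1` W).
Proof. by rewrite -[LHS]/((f2 \o f) @^-1` W) -gf. Qed.

Let image_gf (A : set X1) : f2 @` (f @` A) = g @` (f1 @` A).
Proof. by rewrite !image_comp gf. Qed.

Let open_preimage_g (W : set Y2) : open W -> open (g @^-1` W).
Proof. by move: W; apply/continuousP. Qed.

(** For an open [W] in [Y2], both sides of the skeletality inclusion for [f] at
    the trace of [W] are the traces of the corresponding sides for [g] at [W],
    and an open set has the same closure in [Y1] as its trace. *)
Lemma skeletal_extension : skeletal g <-> skeletal f.
Proof.
have trace_int (W : set Y2) : open W ->
    interior (f @^-1` closure (f2 @^-1` W)) =
    f1 @^-1` interior (g @^-1` closure W).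
  move=> oW; rewrite (closure_preimage_open h2 d2)// preimage_gf.
  rewrite (interior_preimage_closed h1 d1)//.
  by apply: preimage_closed; [move=> ? _; exact: cg|exact: closed_closure].
have trace_cl (W : set Y2) : open W ->
    closure (f @^-1` (f2 @^-1` W)) = f1 @^-1` closure (g @^-1` W).
  move=> oW; rewrite preimage_gf (closure_preimage_open h1 d1)//.
  exact: open_preimage_g.
split=> [sg V oV|sf W oW].
  have [W oW ->] := open_is_trace h2 oV.
  by rewrite trace_int// trace_cl//; apply: preimage_subset; exact: sg.
have oV : open (f2 @^-1` W) by move/continuousP: cf2; apply.
have := sf _ oV; rewrite trace_int// trace_cl// => sub.
apply: (subset_trans (sub_closure_trace d1 (@open_interior _ _) sub)).
by apply: closure_sub_closed; [exact: closed_closure|move=> _ [x ? <-]].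
Qed.

(** The open set [g @` extent f1 B] lies in [extent f2 (closure (f @` B))]
    because its trace lies in the closure of [f @` B]; compactness is what makes
    the closure of [g @` (f1 @` A)] an image under [g]. *)
Lemma open_extension_ll (A B : set X1) :
  open_map g -> compact (closure (f1 @` A)) ->
  closure (f1 @` A) `<=` extent f1 B ->
  closure (f2 @` (f @` A)) `<=` extent f2 (closure (f @` B)).
Proof.
move=> [_ og] cA AB; rewrite image_gf closure_image_compact//.
apply: (subset_trans (image_subset g AB)).
apply/sub_extent; first exact/og/open_extent.
rewrite -(preimage_closure_image h2) image_gf; apply: preimage_subset.
apply: subset_trans (image_closure cg); apply: image_subset.
exact: extent_sub_closure.
Qed.

(** With [E] the open set that (O) provides for two nested compact neighbourhoods
    of a point [y], the larger one being [closure H], the point [g y] is in [E]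
    and [E] is included in [g @` closure H]. *)
Lemma cond_O_open : cond_O rho1 BB1 rho2 f -> open_map g.
Proof.
move=> cO; split=> // U oU; rewrite openE => _ [y Uy <-].
have [H [oH Hy cH HU]] := locally_compact_regular hY1 lY1 oU Uy.
have [V [oV Vy cV VH]] := locally_compact_regular hY1 lY1 oH Hy.
have rV := closure_open_regclosed oV.
have rH := closure_open_regclosed oH.
have VHll : rc_ll rho1 (f1 @^-1` closure V) (f1 @^-1` closure H).
  apply/(rc_ll_lc_proxE h1).
  rewrite (closure_image_preimage_regclosed h1 d1)//.
  rewrite (extent_preimage_closed d1); last exact: closed_closure.
  exact: subset_trans (open_sub_interior_closure oH).
have := cO _ _ (ex_intro2 _ _ _ (conj cV rV) erefl)
  (regclosed_preimage h1 d1 rH) VHll.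
move/(rc_ll_lc_proxE h2); rewrite closure_image_closure// image_gf.
set E := extent _ _ => VE.
have Ey : E (g y).
  apply: VE; apply: image_closure => //; exists y => //.
  rewrite (closure_image_preimage_regclosed h1 d1)//.
  exact: subset_closure.
have nE : nbhs (g y) E.
  by apply: open_nbhs_nbhs; split=> //; exact: open_extent.
apply: filterS nE.
apply: (subset_trans (extent_sub_closure d2 (G := _))).
rewrite closure_image_closure// image_gf.
rewrite closure_image_compact// (closure_image_preimage_regclosed h1 d1)//.
exact: image_subset.
Qed.

(** By [prox_ext_lc_proxE] both orders compare the same closure with the same
    [extent]. *)
Lemma cond_O1_O :
  cond_O1 rho1 BB1 rho2 BB2 f <-> cond_O rho1 BB1 rho2 f.
Proof.
by split=> H F G bF rG FG; have := H F G bF rG FG;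
  rewrite (ext_ll_lc_proxE h2 d2 hY2 lY2) (rc_ll_lc_proxE h2).
Qed.

Lemma open_cond_O2 : open_map g -> cond_O2 rho1 BB1 rho2 BB2 f.
Proof.
move=> og A [F bF AF] B; rewrite (ext_ll_lc_proxE h1 d1 hY1 lY1).
rewrite (ext_ll_lc_proxE h2 d2 hY2 lY2) => AB.
by apply: open_extension_ll => //; exact: lc_bounded_compact bF AF.
Qed.

Lemma cond_O2_O1 :
  cond_O2 rho1 BB1 rho2 BB2 f -> cond_O1 rho1 BB1 rho2 BB2 f.
Proof.
move=> cO2 F G bF rG FG; have : ext_ll rho1 BB1 F G.
  by rewrite (ext_ll_lc_proxE h1 d1 hY1 lY1) -(rc_ll_lc_proxE h1).
move=> /(cO2 F (ex_intro2 _ _ F bF (@subset_refl _ F))).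
by rewrite !(ext_ll_lc_proxE h2 d2 hY2 lY2) closure_image_closure.
Qed.

Lemma open_extension_O : open_map g <-> cond_O rho1 BB1 rho2 f.
Proof.
split; last exact: cond_O_open.
by move=> /open_cond_O2/cond_O2_O1/cond_O1_O.
Qed.

Lemma trace_preimage_interior (K : set Y2) :
  closed K ->
  closure (f @^-1` interior (f2 @^-1` K)) =
  closure (f1 @^-1` (g @^-1` interior K)).
Proof. by move=> clK; rewrite (interior_preimage_closed h2 d2)// preimage_gf. Qed.

Let open_preimage_interior (K : set Y2) : open (g @^-1` interior K).
Proof. exact/open_preimage_g/open_interior. Qed.

Lemma closure_preimage_interior (K : set Y2) :
  closed K -> closure (g @^-1` interior K) `<=` g @^-1` K.
Proof.
move=> clK; have clgK : closed (g @^-1` K).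
  by apply: preimage_closed => // ? _; exact: cg.
apply: closure_sub_closed => //; apply: preimage_subset.
exact: interior_subset.
Qed.

(** Both conditions amount to the compactness of the preimages by [g] of compact
    sets, since each compact set of [Y2] lies in the interior of a compact
    regular closed one. *)
Lemma perfect_extension : perfect_map g <-> cond_P BB1 BB2 f.
Proof.
split=> [pg _ [K [cK rK] <-]|cP].
  have clK := regclosed_closed rK.
  rewrite trace_preimage_interior//.
  apply/(lc_bounded_closure_preimage h1 d1) => //.
  apply: (subclosed_compact _ (perfect_preimage_compact pg cK)).
    exact: closed_closure.
  exact: closure_preimage_interior.
apply: compact_preimage_perfect => // C cC.
have [V [oV CV cV _]] := locally_compact_interpolation hY2 lY2 cC openT
  (@subsetT _ _).
have rV := closure_open_regclosed oV.
have := cP _ (ex_intro2 _ _ _ (conj cV rV) erefl).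
rewrite trace_preimage_interior; last exact: closed_closure.
move/(lc_bounded_closure_preimage h1 d1 (open_preimage_interior _)) => cg'.
apply: (subclosed_compact _ cg').
  by apply: preimage_closed; [move=> ? _; exact: cg|exact: compact_closed].
apply: subset_trans (@subset_closure _ _); apply: preimage_subset.
exact: subset_trans (open_sub_interior_closure oV).
Qed.

(** The ranges of [g] and of [f2 \o f] have the same closure, as [g] is
    continuous and [range f1] is dense; its trace is the closure of [range f]. *)
Lemma dense_range_extension :
  closure (range g) = [set: Y2] <-> closure (range f) = [set: X2].
Proof.
have -> : closure (range g) = closure (f2 @` range f).
  rewrite image_gf -[RHS]closure_image_closure//; congr (closure (g @` _)).
  by rewrite -[in RHS](preimage_setT f1) closure_image_preimage// ?closureT//;
    exact: openT.
rewrite -(preimage_closure_image h2); split=> [->//|fT].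
apply/seteqP; split=> //.
rewrite -closureT -(closure_image_preimage d2 openT) preimage_setT.
apply: closure_sub_closed; first exact: closed_closure.
move=> _ [x _ <-].
by have : [set: X2] x by []; rewrite -fT.
Qed.

(** If [g] is injective, disjoint compact sets have disjoint compact images,
    and two nested compact neighbourhoods of the first image avoid the second.
    Conversely, for disjoint compact neighbourhoods of [y] and [y'], the nested
    sets given by (I) have [g y] inside and [g y'] outside. *)
Lemma injective_extension : injective g <-> cond_I rho1 BB1 rho2 BB2 f.
Proof.
split=> [ig _ _ [K1 [cK1 rK1] <-] [K2 [cK2 rK2] <-]|cI y y' gyy'].
  move/not_lc_proxE; rewrite !(closure_image_preimage_regclosed h1 d1)// => K12.
  have clgK2 : closed (g @` K2).
    by apply: compact_closed => //; exact: continuous_compact_image.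
  have [|||V2 [oV2 K1V2 cV2 V2K2]] := @locally_compact_interpolation _
    (g @` K1) (~` (g @` K2)) hY2 lY2.
  - exact: continuous_compact_image.
  - exact: closed_openC.
  - by move=> _ [y /K12 nK2 <-] [z Kz /ig zy]; apply: nK2; rewrite -zy.
  have [|V1 [oV1 K1V1 cV1 V1V2]] := @locally_compact_interpolation _
    (g @` K1) V2 hY2 lY2 _ oV2 K1V2; first exact: continuous_compact_image.
  have r1 := closure_open_regclosed oV1.
  have r2 := closure_open_regclosed oV2.
  exists (f2 @^-1` closure V1), (f2 @^-1` closure V2); split.
  - by exists (closure V1).
  - by exists (closure V2).
  - apply/(rc_ll_lc_proxE h2).
    rewrite (closure_image_preimage_regclosed h2 d2)//.
    rewrite (extent_preimage_closed d2); last exact: closed_closure.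
    exact: subset_trans (open_sub_interior_closure oV2).
  - rewrite trace_preimage_interior; last exact: closed_closure.
    apply: subset_trans (@subset_closure _ _) => x Kx.
    by apply/(open_sub_interior_closure oV1)/K1V1; exists (f1 x).
  - apply/not_lc_proxE.
    rewrite trace_preimage_interior; last exact: closed_closure.
    rewrite (closure_preimage_open h1 d1)//.
    rewrite !(closure_image_preimage_regclosed h1 d1)//; last first.
      exact: closure_open_regclosed.
    move=> z /closure_preimage_interior-/(_ (@closed_closure _ _)) Vz Kz.
    by apply: (V2K2 _ Vz); exists z.
apply: contrapT => yy'.
have oy' : open (~` [set y']).
  exact/closed_openC/(compact_closed hY1)/compact_set1.
have [V [oV Vy cV Vy']] := locally_compact_regular hY1 lY1 oy' yy'.
have oV' : open (~` closure V) by exact/closed_openC/closed_closure.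
have nVy' : (~` closure V) y' by move=> /Vy'; apply.
have [W [oW Wy' cW WV]] := locally_compact_regular hY1 lY1 oV' nVy'.
have rV := closure_open_regclosed oV.
have rW := closure_open_regclosed oW.
have [|_ [_ [[L1 [cL1 rL1] <-] [L2 [cL2 rL2] <-]]]] :=
    cI _ _ (ex_intro2 _ _ _ (conj cV rV) erefl)
      (ex_intro2 _ _ _ (conj cW rW) erefl).
  apply/not_lc_proxE; rewrite !(closure_image_preimage_regclosed h1 d1)//.
  by move=> z Vz /WV.
have clL1 := regclosed_closed rL1; have clL2 := regclosed_closed rL2.
move=> /(rc_ll_lc_proxE h2).
rewrite (closure_image_preimage_regclosed h2 d2)// (extent_preimage_closed d2)//.
rewrite !trace_preimage_interior// => L12 VL1 /not_lc_proxE.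
rewrite closure_image_closure; last by case: h1.
rewrite (closure_image_preimage d1)//.
rewrite (closure_image_preimage_regclosed h1 d1)//.
move=> /(_ y' _ (subset_closure Wy')); apply.
apply: subset_closure; rewrite /preimage/= -gyy'; apply: L12.
apply: closure_preimage_interior => //.
move: VL1; rewrite (closure_preimage_open h1 d1)// => VL1.
have : closure V `<=` closure (g @^-1` interior L1).
  rewrite -(closure_image_preimage_regclosed h1 d1 rV).
  by apply: closure_sub_closed; [exact: closed_closure|move=> _ [x /VL1 ? <-]].
by apply; exact: subset_closure.
Qed.

(** For an open [g] and a regular closed [L], the closure of
    [g @^-1` interior L] is [g @^-1` L]. If [g] is moreover injective, a regular
    closed [K] is obtained from the closure of the image of its interior.
    Conversely, a regular closed neighbourhood of [y] that avoids [y'] can only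
    be a preimage when [g y] and [g y'] differ. *)
Lemma open_injective_extension :
  open_map g -> (injective g <-> cond_OI f).
Proof.
move=> og; split=> [ig F rF|cOI y y' gyy'].
  have oV : open (g @` interior (closure (f1 @` F))).
    by case: og => _; apply; exact: open_interior.
  have rV := closure_open_regclosed oV.
  exists (f2 @^-1` closure (g @` interior (closure (f1 @` F)))).
    exact: (regclosed_preimage h2 d2).
  rewrite trace_preimage_interior; last exact: closed_closure.
  rewrite (closure_preimage_open h1 d1)//.
  rewrite open_map_preimage_closure// rV -open_map_preimage_closure//.
  have -> : g @^-1` (g @` interior (closure (f1 @` F))) =
      interior (closure (f1 @` F)).
    by apply/seteqP; split=> [x [z Fz /ig <-]//|x Fx]; exists x.
  rewrite (regclosed_closure_image h1 d1 rF).
  by rewrite (preimage_closure_image_regclosed h1).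
apply: contrapT => yy'.
have oy' : open (~` [set y']).
  exact/closed_openC/(compact_closed hY1)/compact_set1.
have [V [oV Vy _ Vy']] := locally_compact_regular hY1 lY1 oy' yy'.
have rV := closure_open_regclosed oV.
have [G rG] := cOI _ (regclosed_preimage h1 d1 rV).
rewrite -(preimage_closure_image_regclosed h2 rG).
set L := closure (f2 @` G).
have rL : regclosed L := regclosed_closure_image h2 d2 rG.
rewrite trace_preimage_interior; last exact: closed_closure.
move=> VL; have {}VL : closure V = g @^-1` L.
  rewrite -(closure_image_preimage_regclosed h1 d1 rV) VL.
  rewrite closure_image_closure; last by case: h1.
  by rewrite closure_image_preimage// open_map_preimage_closure// rL.
apply: (Vy' y') => //; rewrite VL /preimage/= -gyy'.
by move/subset_closure: Vy; rewrite VL.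
Qed.

Lemma perfect_surjective_extension :
  perfect_map g /\ range g = [set: Y2] <->
  cond_P BB1 BB2 f /\ closure (range f) = [set: X2].
Proof.
rewrite -dense_range_extension -perfect_extension.
split=> -[pg rg]; split=> //; first by rewrite rg closureT.
rewrite -rg; apply/closure_id; case: pg => -[_ + _]; apply; exact: closedT.
Qed.

End Extension.

Unset Implicit Arguments.

Theorem theorem3p5 (X1 X2 Y1 Y2 : topologicalType)
    (f1 : X1 -> Y1) (f2 : X2 -> Y2) (f : X1 -> X2) (g : Y1 -> Y2) :
  let rho1 := lc_prox f1 in let BB1 := lc_bounded f1 in
  let rho2 := lc_prox f2 in let BB2 := lc_bounded f2 in
  tychonoff_space X1 -> tychonoff_space X2 ->
  hausdorff_local_compactification f1 ->
  hausdorff_local_compactification f2 ->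
  R_equicontinuous rho1 BB1 rho2 BB2 f ->
  continuous g -> g \o f1 = f2 \o f ->
  (* (a) *)
  (skeletal g <-> skeletal f) /\
  (* (b) *)
  (open_map g <-> skeletal f /\ cond_O rho1 BB1 rho2 f) /\
  (* (b') *)
  (open_map g <-> cond_O1 rho1 BB1 rho2 BB2 f) /\
  (* (b'') *)
  (open_map g <-> cond_O2 rho1 BB1 rho2 BB2 f) /\
  (* (c) *)
  (perfect_map g <-> cond_P BB1 BB2 f) /\
  (* (d) *)
  (closure (range g) = [set: Y2] <-> closure (range f) = [set: X2]) /\
  (* (e) *)
  (injective g <-> cond_I rho1 BB1 rho2 BB2 f) /\
  (* (f) *)
  ((open_map g /\ injective g <->
      cond_O1 rho1 BB1 rho2 BB2 f /\ cond_OI f) /\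
   (cond_O1 rho1 BB1 rho2 BB2 f <-> skeletal f /\ cond_O rho1 BB1 rho2 f)) /\
  (* (g) *)
  (perfect_map g /\ range g = [set: Y2] <->
     cond_P BB1 BB2 f /\ closure (range f) = [set: X2]).
Proof.
move=> rho1 BB1 rho2 BB2 _ _ lc1 lc2 _ cg gf.
have sk := skeletal_extension lc1 lc2 cg gf.
have oO := open_extension_O lc1 lc2 cg gf.
have O1O := @cond_O1_O X1 X2 Y1 Y2 f1 f2 f lc2.
have oSO : open_map g <-> skeletal f /\ cond_O rho1 BB1 rho2 f.
  split=> [og|[_ /oO//]]; split; last exact/oO.
  exact/sk/open_map_skeletal.
have oO1 : open_map g <-> cond_O1 rho1 BB1 rho2 BB2 f by rewrite oO O1O.
split; first exact: sk.
split; first exact: oSO.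
split; first exact: oO1.
split.
  split; first exact: (open_cond_O2 lc1 lc2 cg gf).
  by move=> /(cond_O2_O1 lc1 lc2)/oO1.
split; first exact: (perfect_extension lc1 lc2 cg gf).
split; first exact: (dense_range_extension lc1 lc2 cg gf).
split; first exact: (injective_extension lc1 lc2 cg gf).
split; last exact: (perfect_surjective_extension lc1 lc2 cg gf).
split; last by rewrite -oO1.
have inj og := open_injective_extension lc1 lc2 cg gf og.
split=> [[og ig]|[/oO1 og cOI]]; split=> //; first exact/oO1.
  exact/(inj og).
exact/(inj og).
Qed.
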